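(* Let $(X,\mathcal{F},\tau)$ be a probabilistic metric space with $\tau$ continuous, endowed with its strong topology, let $x=\{x_k\}_{k\in\mathbb{N}}$ be a sequence in $X$, let $\lambda\in\Delta_\infty$ and let $\alpha\in X$. If $x$ is strongly $\lambda$-statistically convergent to $\alpha$, then $\Lambda_x^{st}(\lambda)^{\mathcal{F}}_{s}=\Gamma_x^{st}(\lambda)^{\mathcal{F}}_{s}=\{\alpha\}$.
   Context: Distance distribution functions: $\mathcal{D}^{+}$ is the set of nondecreasing functions $h:[0,\infty]\to[0,1]$ with $h(0)=0$, $h(\infty)=1$, left continuous on $(0,\infty)$; where negative arguments occur, $h$ is extended by $h(x)=0$ for $x<0$. $\mathcal{D}^+$ is ordered pointwise. $\epsilon_0\in\mathcal{D}^+$ is given by $\epsilon_0(x)=0$ for $x\le 0$ and $\epsilon_0(x)=1$ for $x>0$. The metric $d_L$ on $\mathcal{D}^+$: $d_L(f,g)$ is the infimum of all $w\in(0,1]$ such that $f(x-w)-w\le g(x)\le f(x+w)+w$ and $g(x-w)-w\le f(x)\le g(x+w)+w$ for every $x\in(-\frac1w,\frac1w)$. A triangle function is a binary operation $\tau$ on $\mathcal{D}^+$ that is commutative, associative, nondecreasing in each place, and has $\epsilon_0$ as identity. Continuity of $\tau$ is with respect to $d_L$. A probabilistic metric (PM) space is a triplet $(X,\mathcal{F},\tau)$ with $X$ a nonempty set, $\mathcal{F}:X\times X\to\mathcal{D}^+$ (write $\mathcal{F}_{xy}=\mathcal{F}(x,y)$) and $\tau$ a triangle function such that for all $x,y,z\in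 X$: $\mathcal{F}_{xx}=\epsilon_0$; $\mathcal{F}_{xy}\ne\epsilon_0$ if $x\ne y$; $\mathcal{F}_{xy}=\mathcal{F}_{yx}$; $\mathcal{F}_{xz}\ge\tau(\mathcal{F}_{xy},\mathcal{F}_{yz})$. For $x\in X$, $r>0$ let $\mathcal{N}_x(r)=\{y\in X:\mathcal{F}_{xy}(r)>1-r\}$. When $\tau$ is continuous these form a neighborhood system of a Hausdorff topology on $X$, the strong topology. $\Delta_\infty$ is the set of non-decreasing sequences $\lambda=\{\lambda_n\}_{n\in\mathbb{N}}$ of positive reals tending to $\infty$ with $\lambda_1=1$ and $\lambda_{n+1}\le\lambda_n+1$ for all $n$. With $I_n=[n-\lambda_n+1,n]$, the $\lambda$-density of $M\subset\mathbb{N}$ is $d_\lambda(M)=\lim_{n\to\infty}\frac{|\{k\in I_n:k\in M\}|}{\lambda_n}$ when the limit exists. ''$M$ does not have $\lambda$-density zero'' means that either $d_\lambda(M)$ exists and is positive, or $M$ fails to have a $\lambda$-density. $x$ is strongly $\lambda$-statistically convergent to $\alpha$ if for every $t>0$, $d_\lambda(\{k\in\mathbb{N}:\mathcal{F}_{x_k\alpha}(t)\le 1-t\})=0$. A sequence $\{y_k\}$ in $X$ converges strongly to $\mathcal{L}\in X$ if for every $t>0$ there is $k_0\in\mathbb{N}$ with $y_k\in\mathcal{N}_{\mathcal{L}}(t)$ for all $k\ge k_0$. A subsequence $\{x_{q_k}\}_{k\in\mathbb{N}}$ of $x$ is $\lambda$-nonthin if the set $\{q_k:k\in\mathbb{N}\}$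 does not have $\lambda$-density zero. $\Lambda_x^{st}(\lambda)^{\mathcal{F}}_{s}$ (strong $\lambda$-statistical limit points of $x$) is the set of $\mathcal{L}\in X$ such that some $\lambda$-nonthin subsequence of $x$ converges strongly to $\mathcal{L}$. $\Gamma_x^{st}(\lambda)^{\mathcal{F}}_{s}$ (strong $\lambda$-statistical cluster points of $x$) is the set of $\mathcal{Y}\in X$ such that for every $t>0$ the set $\{k\in\mathbb{N}:\mathcal{F}_{x_k\mathcal{Y}}(t)>1-t\}$ does not have $\lambda$-density zero. *)

(* Defs.v *)
From HB Require Import structures.
From mathcomp Require Import all_boot all_order all_algebra finmap.
From mathcomp Require Import all_classical all_reals all_analysis.

Set Implicit Arguments.
Unset Strict Implicit.
Unset Printing Implicit Defensive.

Import Order.TTheory GRing.Theory Num.Theory.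
Import numFieldNormedType.Exports.

Local Open Scope classical_set_scope.
Local Open Scope ring_scope.

(* The functions [0, +oo] -> [0, 1] are represented by their extension by 0 to
   the whole extended line, so [h (x - w)%:E] makes sense for x < w and
   Leibniz equality of two elements means equality on [0, +oo]. *)
Record is_distance_distr (R : realType) (h : \bar R -> R) : Prop := {
  dd_range : forall x, 0 <= h x <= 1 ;
  dd_ndecr : forall x y, (x <= y)%E -> h x <= h y ;
  dd_lt0   : forall x, (x < 0)%E -> h x = 0 ;
  dd_at0   : h 0%E = 0 ;
  dd_aty   : h +oo%E = 1 ;
  dd_left_cts : forall r : R, 0 < r -> h s%:E @[s --> r^'-] --> h r%:E
}.

Record distance_distr (R : realType) : Type := DistanceDistr {
  dd_fun :> \bar R -> R ;
  dd_axioms : is_distance_distr dd_fun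
}.

Definition dd_le (R : realType) (f g : distance_distr R) : Prop :=
  forall x, f x <= g x.

Definition eps0_fun (R : realType) (x : \bar R) : R :=
  if (0 < x)%E then 1 else 0.

Lemma eps0_subproof (R : realType) : is_distance_distr (@eps0_fun R).
Proof.
rewrite /eps0_fun; split.
- by move=> x; case: ifP; rewrite ?lexx ?ler01.
- move=> x y xy; case: ifP => [x0|_]; first by rewrite (lt_le_trans x0 xy).
  by case: ifP.
- by move=> x x0; rewrite ltNge (ltW x0).
- by rewrite ltxx.
- by rewrite ltry.
- move=> r r0; rewrite lte_fin r0; apply: cvg_near_cst.
  near=> s; have s0 : 0 < s by near: s; exact: nbhs_left_gt.
  by rewrite lte_fin s0.
Unshelve. all: by end_near. Qed.

Definition eps0 (R : realType) : distance_distr R :=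
  DistanceDistr (eps0_subproof R).

Definition dL_cond (R : realType) (f g : distance_distr R) (w : R) : Prop :=
  forall x : R, - w^-1 < x -> x < w^-1 ->
    f (x - w)%:E - w <= g x%:E <= f (x + w)%:E + w /\
    g (x - w)%:E - w <= f x%:E <= g (x + w)%:E + w.

(* The set is nonempty (it contains 1) and bounded below by 0, so [inf] is the
   genuine infimum. *)
Definition dL (R : realType) (f g : distance_distr R) : R :=
  inf [set w | 0 < w <= 1 /\ dL_cond f g w].

Record is_triangle_function (R : realType)
    (tau : distance_distr R -> distance_distr R -> distance_distr R)
    : Prop := {
  tf_comm  : commutative tau ;
  tf_assoc : associative tau ;
  tf_ndecl : forall f g h, dd_le f g -> dd_le (tau f h) (tau g h) ;
  tf_ndecr : forall f g h, dd_le f g -> dd_le (tau h f) (tau h g) ;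
  tf_id1l  : left_id (eps0 R) tau ;
  tf_id1r  : right_id (eps0 R) tau
}.

Definition dL_continuous (R : realType)
    (tau : distance_distr R -> distance_distr R -> distance_distr R) : Prop :=
  forall (f g : distance_distr R) (e : R), 0 < e ->
    exists2 d : R, 0 < d &
      forall f' g' : distance_distr R, dL f f' < d -> dL g g' < d ->
        dL (tau f g) (tau f' g') < e.

Record is_pm_space (R : realType) (X : Type) (F : X -> X -> distance_distr R)
    (tau : distance_distr R -> distance_distr R -> distance_distr R)
    : Prop := {
  pm_inhabited : inhabited X ;
  pm_triangle_function : is_triangle_function tau ;
  pm_refl : forall x, F x x = eps0 R ;
  pm_sep  : forall x y, x <> y -> F x y <> eps0 R ;
  pm_sym  : forall x y, F x y = F y x ;
  pm_triangle : forall x y z, dd_le (tau (F x y) (F y z)) (F x z)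
}.

Definition strong_nbhd (R : realType) (X : Type)
    (F : X -> X -> distance_distr R) (x : X) (r : R) : set X :=
  [set y | F x y r%:E > 1 - r].

Definition strong_cvg (R : realType) (X : Type)
    (F : X -> X -> distance_distr R) (y : nat -> X) (L : X) : Prop :=
  forall t : R, 0 < t ->
    exists k0 : nat, forall k, (k0 <= k)%N -> strong_nbhd F L t (y k).

(* All sequences are indexed from 0: index k stands for the (k+1)-st term.
   Shifting both ends of the window [n - lambda_n + 1, n] by one leaves its
   formula unchanged, so only the normalisation lambda_1 = 1 is affected. *)
Record Delta_infty (R : realType) (lam : nat -> R) : Prop := {
  Delta_pos   : forall n, 0 < lam n ;
  Delta_ndecr : nondecreasing_seq lam ;
  Delta_cvgy  : lam n @[n --> \oo] --> +oo ;
  Delta_first : lam 0%N = 1 ;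
  Delta_step  : forall n, lam n.+1 <= lam n + 1
}.

Definition window (R : realType) (lam : nat -> R) (n : nat) : set nat :=
  [set k | n%:R - lam n + 1 <= (k%:R : R) <= n%:R].

Definition has_lambda_density (R : realType) (lam : nat -> R) (M : set nat)
    (d : R) : Prop :=
  (#|` fset_set (window lam n `&` M)|)%:R / lam n @[n --> \oo] --> d.

Definition not_lambda_density_zero (R : realType) (lam : nat -> R)
    (M : set nat) : Prop :=
  (exists2 d : R, has_lambda_density lam M d & 0 < d) \/
  ~ (exists d : R, has_lambda_density lam M d).

Definition strong_lambda_stat_cvg (R : realType) (X : Type)
    (F : X -> X -> distance_distr R) (lam : nat -> R) (x : nat -> X)
    (alpha : X) : Prop :=
  forall t : R, 0 < t ->
    has_lambda_density lam [set k | F (x k) alpha t%:E <= 1 - t] 0.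

Definition nonthin (R : realType) (lam : nat -> R) (q : nat -> nat) : Prop :=
  not_lambda_density_zero lam (range q).

Definition strong_lambda_stat_limit_points (R : realType) (X : Type)
    (F : X -> X -> distance_distr R) (lam : nat -> R) (x : nat -> X) : set X :=
  [set L | exists q : nat -> nat,
    [/\ {homo q : m n / (m < n)%N}, nonthin lam q & strong_cvg F (x \o q) L]].

Definition strong_lambda_stat_cluster_points (R : realType) (X : Type)
    (F : X -> X -> distance_distr R) (lam : nat -> R) (x : nat -> X) : set X :=
  [set Y | forall t : R, 0 < t ->
    not_lambda_density_zero lam [set k | F (x k) Y t%:E > 1 - t]].

(* Main.v *)
(** Two neighbourhoods of distinct points can be separated because [tau] is
    continuous at [(eps0, eps0)], so a cluster point other than [alpha] would be
    visited only on a lambda-density-zero set. Conversely the density-zero sets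
    form a P-ideal: the exceptional sets [A j] belonging to the radii [1 / (j + 1)]
    are all contained, up to finitely many indices, in one density-zero set [B],
    and [x] converges to [alpha] along the complement of [B]. The complement is
    nonthin since the windows contain at least [lambda_n / 2] indices. *)
Require Import Defs.
From HB Require Import structures.
From mathcomp Require Import all_boot all_order all_algebra finmap.
From mathcomp Require Import all_classical all_reals all_analysis.
From mathcomp Require Import lra.

Import Order.TTheory GRing.Theory Num.Theory.
Import numFieldNormedType.Exports.

Local Open Scope classical_set_scope.
Local Open Scope ring_scope.

(** * Distance distribution functions close to [eps0], and separation of points *)

Lemma distance_distr_ext {R : realType} (f g : distance_distr R) :
  dd_fun f =1 dd_fun g -> f = g.
Proof.
case: f => f fP; case: g => g gP /= /funext fg.
by rewrite -fg in gP *; congr DistanceDistr; exact: Prop_irrelevance.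
Qed.

Lemma eq_eps0 {R : realType} (f : distance_distr R) :
  (forall s : R, 0 < s -> f s%:E = 1) -> f = eps0 R.
Proof.
move=> f1; apply: distance_distr_ext => -[s| |] /=; rewrite /eps0_fun.
- rewrite lte_fin; case: ltP => [|s0]; first exact: f1.
  move: s0; rewrite le_eqVlt => /predU1P[->|s0].
    exact: (dd_at0 (dd_axioms f)).
  by apply: (dd_lt0 (dd_axioms f)); rewrite lte_fin.
- by rewrite ltry; exact: (dd_aty (dd_axioms f)).
- by rewrite ltNge leNye; apply: (dd_lt0 (dd_axioms f)); exact: ltNyr.
Qed.

Lemma gt_subr_ndecr {R : realType} (f : distance_distr R) (s t : R) :
  s <= t -> 1 - s < f s%:E -> 1 - t < f t%:E.
Proof.
move=> st; have : f s%:E <= f t%:E.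
  by apply: (dd_ndecr (dd_axioms f)); rewrite lee_fin.
by move: (f s%:E) (f t%:E) => a b ab sa; lra.
Qed.

(** The number [t] is itself admissible in the infimum: where [eps0] requires [f] to be near 1, the
    argument of [f] is at least [t], and where it requires [f] to be near 0, that argument is
    negative. Together with [dL_eps0_lt] this translates between strong neighbourhoods and [dL]. *)
Lemma dL_eps0_le {R : realType} (f : distance_distr R) (t : R) :
  0 < t -> t <= 1 -> 1 - t < f t%:E -> dL (eps0 R) f <= t.
Proof.
move=> t0 t1 ft; apply: ge_inf.
  by exists 0 => w /= [/andP[/ltW]].
split; first by rewrite t0.
have fle x y : x <= y -> f x%:E <= f y%:E.
  by move=> xy; apply: (dd_ndecr (dd_axioms f)); rewrite lee_fin.
have f01 x : 0 <= f x%:E <= 1 := dd_range (dd_axioms f) x%:E.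
have f0 x : x < 0 -> f x%:E = 0.
  by move=> x0; apply: (dd_lt0 (dd_axioms f)); rewrite lte_fin.
have e0E x : eps0 R x%:E = if 0 < x then 1 else 0.
  by rewrite /= /eps0_fun lte_fin.
move=> x _ _; rewrite !e0E; split.
- apply/andP; split; case: ltP => x0.
  + have := fle t x; lra.
  + have := f01 x; lra.
  + have := f01 x; lra.
  + rewrite f0; lra.
- apply/andP; split; case: ltP => x0.
  + have := f01 (x - t); lra.
  + rewrite f0; lra.
  + have := fle t (x + t); lra.
  + have := f01 (x + t); lra.
Qed.

Lemma dL_eps0_lt {R : realType} (f : distance_distr R) (e : R) :
  e <= 1 -> dL (eps0 R) f < e -> 1 - e <= f e%:E.
Proof.
move=> e1 /inf_lt[|w [/andP[w0 w1] fw] we].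
  (* The infimum is over a nonempty set, since 1 is always admissible. *)
  exists 1; split; first by rewrite ltr01 lexx.
  have f01 h (x : R) : 0 <= dd_fun h x%:E <= 1 := dd_range (dd_axioms h) x%:E.
  move=> x _ _; have := (f01 f (x - 1), f01 f x, f01 f (x + 1)).
  have := (f01 (eps0 R) (x - 1), f01 (eps0 R) x, f01 (eps0 R) (x + 1)).
  by move: (dd_fun (eps0 R)) (dd_fun f) => g h [[? ?] ?] [[? ?] ?]; lra.
have w1' : 1 <= w^-1 by rewrite invf_ge1.
(* The midpoint of [w] and [e] exceeds [w], so [eps0] is 1 after the shift by [w], and it stays
   below 1, inside the range of [dL_cond]. *)
have [||/andP[+ _] _] := fw ((w + e) / 2); [lra|lra|].
rewrite /= /eps0_fun lte_fin; case: ltP => [_|]; last by lra.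
have : f ((w + e) / 2)%:E <= f e%:E.
  by apply: (dd_ndecr (dd_axioms f)); rewrite lee_fin; lra.
lra.
Qed.

(** If the neighbourhoods met at every radius, a common point [z] would put both [F x z] and [F z y]
    near [eps0]. The triangle inequality then forces [F x y] to be [eps0]. *)
Lemma strong_nbhd_separation {R : realType} {X : Type}
    (F : X -> X -> distance_distr R) tau (x y : X) :
  is_pm_space F tau -> dL_continuous tau -> x <> y ->
  exists2 t : R, 0 < t &
    forall z, ~ (1 - t < F z x t%:E /\ 1 - t < F z y t%:E).
Proof.
move=> pmX tauc xy; apply: contrapT => nsep; apply: (pm_sep pmX xy).
apply: eq_eps0 => s s0; apply/eqP; rewrite eq_le.
have /andP[_ ->] /= := dd_range (dd_axioms (F x y)) s%:E.
apply/ler_addgt0Pl => e e0.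
(* The cap [e] makes the error small, [s] lets monotonicity pass from [r] to [s], and 1 is the range
   of [dL_eps0_lt]. *)
pose r := Num.min (Num.min e s) 1.
have [r0 [re rs r1]] : 0 < r /\ [/\ r <= e, r <= s & r <= 1].
  by rewrite /r !lt_min e0 s0 ltr01 !ge_min !lexx !orbT.
have [d d0 dP] := tauc (eps0 R) (eps0 R) _ r0.
pose t := Num.min (d / 2) 1.
have [t0 td t1] : [/\ 0 < t, t < d & t <= 1].
  have [d20 d2d] : 0 < d / 2 /\ d / 2 < d by split; lra.
  by rewrite /t lt_min gt_min ge_min d20 d2d ltr01 lexx orbT.
have [z [zx zy]] : exists z, 1 - t < F z x t%:E /\ 1 - t < F z y t%:E.
  apply: contrapT => nz; apply: nsep; exists t => // z zP.
  by apply: nz; exists z.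
have : dL (eps0 R) (tau (F x z) (F z y)) < r.
  have := dP (F x z) (F z y).
  rewrite (tf_id1l (pm_triangle_function pmX)); apply.
    by apply: le_lt_trans td; apply: dL_eps0_le; rewrite // (pm_sym pmX).
  by apply: le_lt_trans td; exact: dL_eps0_le.
move/(dL_eps0_lt _ _ r1).
move/le_trans => /(_ _ (pm_triangle pmX x z y r%:E)).
have : F x y r%:E <= F x y s%:E.
  by apply: (dd_ndecr (dd_axioms (F x y))); rewrite lee_fin.
lra.
Qed.

(** * Window ratios and sets of lambda-density zero *)

Definition window_ratio {R : realType} (lam : nat -> R) (M : set nat) (n : nat)
  : R := (#|` fset_set (window lam n `&` M)|)%:R / lam n.

Section density.
Context {R : realType} {lam : nat -> R} (lamD : Delta_infty lam).

Lemma finite_window n M : finite_set (window lam n `&` M).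
Proof.
apply: (sub_finite_set (B := `I_n.+1)); last exact: finite_II.
by move=> k [/= /andP[_]]; rewrite ler_nat ltnS.
Qed.

Lemma window_ratio_ge0 M n : 0 <= window_ratio lam M n.
Proof. by rewrite divr_ge0// ltW// (Delta_pos lamD). Qed.

(** The restriction to [k <= n] matters in [density0_pseudounion], where the inclusion is only
    available up to [n]. *)
Lemma window_ratio_le A B n :
  (forall k, (k <= n)%N -> A k -> B k) ->
  window_ratio lam A n <= window_ratio lam B n.
Proof.
move=> AB; rewrite ler_pM2r ?invr_gt0 ?(Delta_pos lamD)// ler_nat.
apply: fsubset_leq_card; rewrite -fset_set_sub; last 2 first.
- exact: finite_window.
- exact: finite_window.
move=> k [kn Ak]; split=> //; apply: AB => //.
by move: kn => /= /andP[_]; rewrite ler_nat.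
Qed.

Lemma window_ratioU A B n :
  window_ratio lam (A `|` B) n <= window_ratio lam A n + window_ratio lam B n.
Proof.
rewrite -mulrDl ler_pM2r ?invr_gt0 ?(Delta_pos lamD)// -natrD ler_nat.
rewrite setIUr fset_setU; [|exact: finite_window..].
by rewrite cardfsU leq_subr.
Qed.

Lemma Delta_le n : lam n <= n.+1%:R.
Proof.
elim: n => [|n ih]; first by rewrite (Delta_first lamD).
by apply: (le_trans (Delta_step lamD n)); rewrite -[n.+2%:R]natr1 lerD2r.
Qed.

Lemma Delta_ge1 n : 1 <= lam n.
Proof. by rewrite -(Delta_first lamD); exact: (Delta_ndecr lamD). Qed.

(** With [m] the integer part of [lam n], the window contains the [m] indices [n], [n - 1], down to
    [n - m + 1], which are natural numbers by [Delta_le]. Since [m >= 1], [lam n < m + 1 <= 2 m]. *)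
Lemma window_ratioT n : 2^-1 <= window_ratio lam setT n.
Proof.
have l1 := Delta_ge1 n; have l0 := Delta_pos lamD n.
have /andP[ml lm] := truncn_itv (ltW l0).
set m := Num.truncn (lam n) in ml lm.
have mn : (m <= n.+1)%N by rewrite -(@ler_nat R); exact: le_trans ml (Delta_le n).
have m1 : (0 < m)%N by rewrite -ltnS -(@ltr_nat R); exact: le_lt_trans lm.
rewrite ler_pdivlMr//.
suff : (m <= #|` fset_set (window lam n `&` setT)|)%N.
  rewrite -(@ler_nat R); move: m1 lm; rewrite -(@ler_nat R) -natr1; lra.
have -> : m = #|` [fset (n - nat_of_ord i)%N | i in 'I_m]%fset|.
  rewrite card_in_imfset /= ?size_enum_ord //.
  have le_n (i : 'I_m) : (i <= n)%N by rewrite -ltnS (leq_trans (ltn_ord i)).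
  by move=> i j _ _ eqij; apply: val_inj; rewrite /= -(subKn (le_n i)) eqij subKn.
apply: fsubset_leq_card; apply/fsubsetP => k /imfsetP[i /= _ ->].
rewrite in_fset_set; last exact: finite_window.
apply/mem_set; split=> //; rewrite /window /=; have im := ltn_ord i.
have ilen : (i <= n)%N by rewrite -ltnS (leq_trans im).
rewrite natrB// lerBlDr lerDl ler0n andbT.
by move: im; rewrite -(@ler_nat R) -natr1; lra.
Qed.

Lemma has_lambda_density0P M :
  has_lambda_density lam M 0 <->
  forall e, 0 < e -> exists N : nat, forall n, (N <= n)%N -> window_ratio lam M n < e.
Proof.
split=> [/cvgr0Pnorm_lt h e /h[N _ NP]|h].
  by exists N => n /NP; rewrite ger0_norm ?window_ratio_ge0.
apply/cvgr0Pnorm_lt => e /h[N NP]; exists N => // n /= /NP.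
by rewrite ger0_norm ?window_ratio_ge0.
Qed.

(** A density is unique and, as a limit of nonnegative ratios, nonnegative. *)
Lemma not_lambda_density_zeroE M :
  not_lambda_density_zero lam M <-> ~ has_lambda_density lam M 0.
Proof.
split=> [[[d dM d0] M0|nd M0]|M0]; last first.
- have [[d dM]|] := pselect (exists d, has_lambda_density lam M d); last by right.
  left; exists d => //; rewrite lt_neqAle; apply/andP; split.
    by apply/eqP => d0; apply: M0; rewrite d0.
  have /= := limr_ge (cvgP _ dM); rewrite (cvg_lim _ dM)//; apply.
  by apply: nearW => n; exact: window_ratio_ge0.
- by apply: nd; exists 0.
- by have := cvg_unique (@Rhausdorff R) dM M0 => dE; rewrite dE ltxx in d0.
Qed.

Lemma density0_finite m : has_lambda_density lam `I_m 0.
Proof.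
apply/has_lambda_density0P => e e0.
have /cvgryPgt/(_ (m%:R / e))[N _ NP] := Delta_cvgy lamD.
exists N => n /NP /=; rewrite ltr_pdivrMr// => lamn.
rewrite ltr_pdivrMr ?(Delta_pos lamD)// mulrC; apply: le_lt_trans lamn.
rewrite ler_nat; apply: geq_card_fset_set; apply: subset_card_le.
exact: subIsetr.
Qed.

(** The part of [A] below [k0] is finite, hence null, and ratios are subadditive. *)
Lemma density0_almost_sub {A B} k0 :
  (forall k, (k0 <= k)%N -> A k -> B k) ->
  has_lambda_density lam B 0 -> has_lambda_density lam A 0.
Proof.
move=> AB /has_lambda_density0P B0; apply/has_lambda_density0P => e e0.
have e2 : 0 < e / 2 by lra.
have [N NP] := B0 _ e2.
have /has_lambda_density0P/(_ _ e2)[N' N'P] := density0_finite k0.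
exists (maxn N N') => n; rewrite geq_max => /andP[/NP h /N'P h'].
suff : window_ratio lam A n <= window_ratio lam (`I_k0 `|` B) n.
  by move=> /le_lt_trans; apply; apply: (le_lt_trans (window_ratioU _ _ _)); lra.
apply: window_ratio_le => k _ Ak.
by have [|/AB] := ltnP k k0; [left|right; auto].
Qed.

Lemma density0_setC M :
  has_lambda_density lam M 0 -> ~ has_lambda_density lam (~` M) 0.
Proof.
move=> /has_lambda_density0P h /has_lambda_density0P h'.
(* Two ratios below [4^-1] would sum to less than the bound [2^-1] of [window_ratioT]. *)
have e0 : 0 < 4^-1 :> R by [].
have [N NP] := h _ e0; have [N' N'P] := h' _ e0.
have := window_ratioU M (~` M) (maxn N N').
rewrite setUv; have := window_ratioT (maxn N N').
have := NP _ (leq_maxl N N'); have := N'P _ (leq_maxr N N'); lra.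
Qed.

Lemma density0_pseudounion {A : nat -> set nat} :
  (forall i j, (i <= j)%N -> A i `<=` A j) ->
  (forall j, has_lambda_density lam (A j) 0) ->
  exists2 B, has_lambda_density lam B 0 &
    forall j, exists k0, forall k, (k0 <= k)%N -> A j k -> B k.
Proof.
move=> Amono A0.
(* The bound [j <= N j] leaves finitely many thresholds below a given [n], so that there is a last
   one. *)
have /choice[N NP] j : exists N, (j <= N)%N /\
    forall n, (N <= n)%N -> window_ratio lam (A j) n < j.+1%:R^-1.
  have /has_lambda_density0P/(_ j.+1%:R^-1)[|N NP] := A0 j.
    by rewrite invr_gt0.
  exists (maxn j N); split; first exact: leq_maxl.
  by move=> n; rewrite geq_max => /andP[_]; exact: NP.
exists [set k | exists2 j, (N j <= k)%N & A j k]; last first.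
  by move=> j; exists (N j) => k Njk Ajk; exists j.
apply/has_lambda_density0P => e e0.
(* From [N j0] on, the last threshold has rank at least [j0], and [1 / (j0 + 1) < e]. *)
pose j0 := Num.truncn e^-1; exists (N j0) => n Nn.
have exJ : exists j, (N j <= n)%N by exists j0.
have ubJ j : (N j <= n)%N -> (j <= n)%N := leq_trans (NP j).1.
(* No later set [A j] has been switched on up to [n], so [A J] covers the union there. *)
have [J NJ maxJ] := ex_maxnP exJ ubJ.
apply: (@le_lt_trans _ _ (window_ratio lam (A J) n)).
  apply: window_ratio_le => k kn [j Njk]; apply: Amono.
  by apply: maxJ; exact: leq_trans kn.
apply: (lt_le_trans ((NP J).2 _ NJ)).
rewrite -[leRHS]invrK lef_pV2 ?posrE ?invr_gt0//.
apply: (le_trans (ltW (truncnS_gt e^-1))); rewrite ler_nat ltnS; exact: maxJ.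
Qed.

End density.

(** * Subsequences, limit points and cluster points *)

Lemma unbounded_nat_enum (M : set nat) :
  (forall m, exists2 k, (m <= k)%N & M k) ->
  exists2 q : nat -> nat, {homo q : m n / (m < n)%N} & range q = M.
Proof.
move=> Minf.
have /choice[nxt nxtP] m : exists k, [/\ (m <= k)%N, M k &
    forall l, (m <= l)%N -> M l -> (k <= l)%N].
  have ex : exists k, (m <= k)%N && `[< M k >].
    by have [k mk Mk] := Minf m; exists k; rewrite mk; apply/asboolP.
  have [k /andP[mk /asboolP Mk] kmin] := ex_minnP ex.
  by exists k; split=> // l ml Ml; apply: kmin; rewrite ml; apply/asboolP.
pose q n := iter n (fun k => nxt k.+1) (nxt 0%N).
have qlt n : (q n < q n.+1)%N by have [] := nxtP (q n).+1.
have qge n : (n <= q n)%N by elim: n => // n ih; exact: leq_trans (qlt n).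
exists q; first exact: (homo_ltn ltn_trans).
apply/seteqP; split=> [_ [n _ <-]|k Mk].
  by case: n => [|n]; [have [] := nxtP 0%N|have [] := nxtP (q n).+1].
have ex : exists n, (k <= q n)%N by exists k.
(* At the first [n] with [k <= q n], the previous value of [q], if any, is below [k], so minimality
   of [nxt] gives [q n <= k]. *)
have [n kq nmin] := ex_minnP ex.
exists n => //; apply/eqP; rewrite eqn_leq kq andbT.
case: n kq nmin => [|n] _ nmin; first by have [_ _] := nxtP 0%N; apply.
have [_ _] := nxtP (q n).+1; apply=> //.
by rewrite ltnNge; apply/negP => /nmin; rewrite ltnn.
Qed.

Lemma stat_cvg_limit_point {R : realType} {X : Type}
    {F : X -> X -> distance_distr R} {lam : nat -> R} {x : nat -> X} {alpha : X} :
  (forall x y, F x y = F y x) -> Delta_infty lam ->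
  strong_lambda_stat_cvg F lam x alpha ->
  strong_lambda_stat_limit_points F lam x alpha.
Proof.
move=> Fsym lamD xalpha.
pose A j := [set k | F (x k) alpha j.+1%:R^-1%:E <= 1 - j.+1%:R^-1].
have Amono i j : (i <= j)%N -> A i `<=` A j.
  move=> ij k; rewrite /A /= !leNgt => /negP Ai; apply/negP => Aj.
  apply: Ai; apply: gt_subr_ndecr Aj.
  by rewrite lef_pV2 ?posrE// ler_nat ltnS.
have [B B0 AB] : exists2 B, has_lambda_density lam B 0 &
    forall j, exists k0, forall k, (k0 <= k)%N -> A j k -> B k.
  by apply: (density0_pseudounion lamD Amono) => j; apply: xalpha; rewrite invr_gt0.
have nB := density0_setC lamD _ B0.
(* A bounded complement of [B] would be null, against [nB]. *)
have [|q qmono qB] := unbounded_nat_enum (~` B).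
  move=> m; apply: contrapT => nm; apply: nB.
  apply: (density0_almost_sub lamD m _ B0) => k mk nBk.
  by exfalso; apply: nm; exists k.
exists q; split=> //.
  by apply/(not_lambda_density_zeroE lamD); rewrite qB.
have qge n : (n <= q n)%N.
  by elim: n => // n ih; apply: leq_ltn_trans ih _; exact: qmono.
(* This choice makes the radius [1 / (j + 1)] at most [t]. *)
move=> t t0; pose j := Num.truncn t^-1.
have [k0 k0P] := AB j; exists k0 => k k0k.
have jt : j.+1%:R^-1 <= t.
  by rewrite -[leRHS]invrK lef_pV2 ?posrE ?invr_gt0// ltW// truncnS_gt.
rewrite /strong_nbhd /= Fsym; apply: (gt_subr_ndecr _ _ _ jt).
rewrite ltNge; apply/negP => /(k0P _ (leq_trans k0k (qge k))) Bq.
by have : (~` B) (q k) by rewrite -qB; exists k.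
Qed.

(** Strong convergence puts the range of [q], from some index on, inside the set of visits to the
    neighbourhood of [L]; were the latter null, the range would be null too. *)
Lemma limit_point_cluster_point {R : realType} {X : Type}
    {F : X -> X -> distance_distr R} {lam : nat -> R} {x : nat -> X} :
  (forall x y, F x y = F y x) -> Delta_infty lam ->
  strong_lambda_stat_limit_points F lam x
    `<=` strong_lambda_stat_cluster_points F lam x.
Proof.
move=> Fsym lamD L [q [qmono /(not_lambda_density_zeroE lamD) qthin qL]] t t0.
apply/(not_lambda_density_zeroE lamD) => M0; apply: qthin.
have [k0 k0P] := qL _ t0.
apply: (density0_almost_sub lamD (q k0) _ M0) => _ /[swap] -[k _ <-] qk0 /=.
rewrite Fsym; apply: k0P; rewrite leqNgt; apply/negP => /qmono.
by rewrite ltnNge qk0.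
Qed.

(** At a separating radius, every visit near [Y] is an exceptional index for [alpha]. *)
Lemma stat_cvg_cluster_point {R : realType} {X : Type}
    {F : X -> X -> distance_distr R} {tau} {lam : nat -> R} {x : nat -> X}
    {alpha : X} :
  is_pm_space F tau -> dL_continuous tau -> Delta_infty lam ->
  strong_lambda_stat_cvg F lam x alpha ->
  strong_lambda_stat_cluster_points F lam x `<=` [set alpha].
Proof.
move=> pmX tauc lamD xalpha Y Yx; apply: contrapT => Yalpha.
have [t t0 sep] := strong_nbhd_separation _ _ _ _ pmX tauc Yalpha.
have /(not_lambda_density_zeroE lamD) := Yx _ t0; apply.
apply: (density0_almost_sub lamD 0%N _ (xalpha _ t0)) => k _ /= kY.
by rewrite leNgt; apply/negP => kalpha; exact: (sep (x k)).
Qed.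

Theorem theorem4p2 (R : realType) (X : Type) (F : X -> X -> distance_distr R)
    (tau : distance_distr R -> distance_distr R -> distance_distr R)
    (x : nat -> X) (lam : nat -> R) (alpha : X)
    (pmX : is_pm_space F tau) (tau_cts : dL_continuous tau)
    (lamD : Delta_infty lam) :
  strong_lambda_stat_cvg F lam x alpha ->
  strong_lambda_stat_limit_points F lam x
    = strong_lambda_stat_cluster_points F lam x /\
  strong_lambda_stat_cluster_points F lam x = [set alpha].
Proof.
move=> xalpha.
have alphaL := stat_cvg_limit_point (pm_sym pmX) lamD xalpha.
have LG := limit_point_cluster_point (x := x) (pm_sym pmX) lamD.
have Galpha := stat_cvg_cluster_point pmX tau_cts lamD xalpha.
(* The inclusions from limit points through cluster points to [[set alpha]] close up because [alpha]
   is a limit point. *)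
split; apply/seteqP; split=> //.
  by move=> _ /Galpha ->.
by move=> _ ->; exact: LG.
Qed.
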